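(* Let $r\ge 1$, $m\ge 1$, $n\ge 1$ be integers. Let $P=\{p_1,p_2,\ldots,p_m\}$ and $Q=\{-q_1,-q_2,\ldots,-q_n\}$, where $p_1,\ldots,p_m,q_1,\ldots,q_n$ are positive integers such that $p_1<p_2<\cdots<p_m$ and $q_1<q_2<\cdots<q_n$, and suppose that the greatest common divisor $t$ of $p_1,\ldots,p_m,q_1,\ldots,q_n$ satisfies $1\le t\le r$. Then there exists an $r$-graph with imbalance set $P\cup Q$.
   Context: For an integer $r\ge 1$, an $r$-graph (short for $r$-digraph) is a finite directed multigraph without loops in which any two distinct vertices are joined by at most $r$ arcs in total (counting arcs in both directions). The imbalance of a vertex $v$ is $b_v=d_v^{+}-d_v^{-}$, where $d_v^{+}$ and $d_v^{-}$ are the outdegree and indegree of $v$ (counted with multiplicity). The imbalance set of an $r$-graph is the set of distinct imbalances of its vertices. *)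

(* Defs.v *)
From mathcomp Require Import all_boot all_order all_algebra.
From mathcomp Require Import finmap.

Set Implicit Arguments.
Unset Strict Implicit.
Unset Printing Implicit Defensive.

Import GRing.Theory.
Local Open Scope ring_scope.
Local Open Scope fset_scope.

(* Parallel arcs are not distinguished: [arcs u v] is the number of arcs
   from [u] to [v]. *)
Record rdigraph (r : nat) := RDigraph {
  vertex : finType;
  arcs : vertex -> vertex -> nat;
  arcs_loopless : forall v, arcs v v = 0%N;
  arcs_bound : forall u v, u != v -> (arcs u v + arcs v u <= r)%N
}.

Arguments arcs {r} G u v : rename.
Arguments vertex {r} G : rename.

Definition outdeg (r : nat) (G : rdigraph r) (v : vertex G) : nat :=
  (\sum_(w : vertex G) arcs G v w)%N.

Definition indeg (r : nat) (G : rdigraph r) (v : vertex G) : nat :=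
  (\sum_(w : vertex G) arcs G w v)%N.

Definition imbalance (r : nat) (G : rdigraph r) (v : vertex G) : int :=
  (outdeg v)%:Z - (indeg v)%:Z.

Definition imbalance_set (r : nat) (G : rdigraph r) : {fset int} :=
  [fset imbalance v | v in vertex G].

(* Main.v *)
(* For positive integers p and q, orienting the complete bipartite graph on
   q + p vertices from the side of size q to the side of size p gives imbalance
   p to the vertices of the first side and -q to those of the second.  The
   required graph is the disjoint union of these graphs over all pairs
   (p_i, -q_j); it has at most one arc between any two vertices. *)

Require Import Defs.
From mathcomp Require Import all_boot all_order all_algebra.
From mathcomp Require Import finmap.

Set Implicit Arguments.
Unset Strict Implicit.
Unset Printing Implicit Defensive.

Import GRing.Theory.
Local Open Scope ring_scope.
Local Open Scope fset_scope.

(** Only the fibre over [i] contributes, one for each of its [F i] elements. *)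
Lemma sum_tag_eq (I : finType) (F : I -> nat) (i : I) :
  (\sum_(x : {k : I & 'I_(F k)}) (i == tag x) = F i)%N.
Proof.
rewrite -(@sig_big_dep _ _ _ _ (fun k => 'I_(F k)) xpredT (fun _ => xpredT)
            (fun k _ => (i == k) : nat)) (bigD1 i) //=.
rewrite eqxx sum1_card card_ord big1 ?addn0 // => k ki.
by rewrite big1 // => l _; rewrite eq_sym (negPf ki).
Qed.

Section BipartiteUnion.

Variables (I : finType) (p q : I -> nat).

(** The tag names the component, [inl] marks sources and [inr] sinks. The sizes are crossed: a
    source's imbalance counts the sinks of its component, and conversely. *)
Definition bipartite_vertex : finType :=
  ({i : I & 'I_(q i)} + {i : I & 'I_(p i)})%type.

Definition bipartite_arcs (u v : bipartite_vertex) : nat :=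
  match u, v with
  | inl x, inr y => tag x == tag y
  | _, _ => 0
  end.

Lemma bipartite_loopless v : bipartite_arcs v v = 0%N.
Proof. by case: v. Qed.

Lemma bipartite_bound r : (0 < r)%N ->
  forall u v, u != v -> (bipartite_arcs u v + bipartite_arcs v u <= r)%N.
Proof.
move=> r_gt0 [x|x] [y|y] _ //=; rewrite ?addn0 ?add0n;
  exact: leq_trans (leq_b1 _) r_gt0.
Qed.

Definition bipartite_union r (r_gt0 : (0 < r)%N) : rdigraph r :=
  RDigraph bipartite_loopless (bipartite_bound r_gt0).

Variables (r : nat) (r_gt0 : (0 < r)%N).

(** No arc enters a source, and its out-neighbours are the sinks with the same tag. *)
Lemma imbalance_source (x : {i : I & 'I_(q i)}) :
  @imbalance r (bipartite_union r_gt0) (inl x) = (p (tag x))%:Z.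
Proof.
rewrite /imbalance /outdeg /indeg /= !big_sumType /= !big1_eq add0n addn0 subr0.
by rewrite sum_tag_eq.
Qed.

Lemma imbalance_sink (y : {i : I & 'I_(p i)}) :
  @imbalance r (bipartite_union r_gt0) (inr y) = - (q (tag y))%:Z.
Proof.
rewrite /imbalance /outdeg /indeg /= !big_sumType /= !big1_eq !addn0 sub0r.
by under eq_bigr => x _ do rewrite eq_sym; rewrite sum_tag_eq.
Qed.

End BipartiteUnion.

Theorem theorem9 (r m n : nat) (hr : (1 <= r)%N) (hm : (1 <= m)%N)
    (hn : (1 <= n)%N) (p : 'I_m -> nat) (q : 'I_n -> nat)
    (p_pos : forall i, (0 < p i)%N) (q_pos : forall j, (0 < q j)%N)
    (p_incr : forall i j : 'I_m, (i < j)%N -> (p i < p j)%N)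
    (q_incr : forall i j : 'I_n, (i < j)%N -> (q i < q j)%N)
    (t : nat)
    (t_gcd : t = gcdn (\big[gcdn/0%N]_(i < m) p i) (\big[gcdn/0%N]_(j < n) q j))
    (t_bound : (1 <= t <= r)%N) :
  exists G : rdigraph r,
    imbalance_set G =
      [fset (p i)%:Z | i in 'I_m] `|` [fset - (q j)%:Z | j in 'I_n].
Proof.
pose P (k : 'I_m * 'I_n) := p k.1; pose Q (k : 'I_m * 'I_n) := q k.2.
exists (bipartite_union P Q hr); apply/fsetP => z; rewrite in_fsetU.
apply/imfsetP/orP => /= [[[x|y] _ ->]|[]/imfsetP[k /= _ ->]].
- by left; rewrite imbalance_source; apply: in_imfset.
- by right; rewrite imbalance_sink; apply: (in_imfset _ (fun j => - (q j)%:Z)).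
(* To realise [p k], any component [(k, j)] serves; [j] is the first index, and a source exists
   there because [q j] is positive. *)
- pose x := Tagged (fun k => 'I_(Q k)) (Ordinal (q_pos (Ordinal hn))
    : 'I_(Q (k, Ordinal hn))).
  by exists (inl x); rewrite // imbalance_source.
(* Symmetrically, a sink of the component [(0, k)] realises [- q k]. *)
- pose y := Tagged (fun k => 'I_(P k)) (Ordinal (p_pos (Ordinal hm))
    : 'I_(P (Ordinal hm, k))).
  by exists (inr y); rewrite // imbalance_sink.
Qed.
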